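(* Let $A,B,H,K$ be logically independent events. The set $\Pi$ of all coherent assessments $(x,y,z,\mu)$ on the family $\mathcal F=\{A|H,\;B|K,\;(A|H)\wedge(B|K),\;(B|K)|(A|H)\}$ (where $x=P(A|H)$, $y=P(B|K)$, $z=\mathbb P[(A|H)\wedge(B|K)]$, $\mu=\mathbb P[(B|K)|(A|H)]$) is $\Pi=\Pi'\cup\Pi''$, where $$\Pi'=\{(x,y,z,\mu): x\in(0,1],\ y\in[0,1],\ z\in[z',z''],\ \mu=\tfrac{z}{x}\},\qquad z'=\max\{x+y-1,0\},\quad z''=\min\{x,y\},$$ and $$\Pi''=\{(0,y,0,\mu): (y,\mu)\in[0,1]^2\}.$$
   Context: Events are elements of a Boolean algebra with sure event $\Omega$ and impossible event $\emptyset$; $\overline{E}$ is negation, $EF$ is conjunction, and an event is identified with its $0/1$ indicator. Events $E_1,\dots,E_n$ are logically independent if all $2^n$ conjunctions of the $E_i$ or their negations are $\neq\emptyset$. The constituents generated by events are the nonimpossible such conjunctions. Given real values $x,y,z,\mu$: the conditional event $A|H$ is (numerically) the quantity $AH+x\overline H$, and $B|K$ is $BK+y\overline K$. The conjunction is the conditional random quantity $(A|H)\wedge(B|K)=\min\{AH+x\overline H,\,BK+y\overline K\}\,|\,(H\vee K)$, i.e. it equals that minimum if $H\vee K$ is true and equals its prevision $z$ if $\overline H\,\overline K$ is true; for $x,y\in[0,1]$ its values are $1$ on $AHBK$, $0$ on $\overline AH\vee\overline BK$, $x$ on $\overline HBK$, $y$ on $AH\overline K$, $z$ on $\overline H\,\overline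 K$. The iterated conditional is $(B|K)|(A|H)=(A|H)\wedge(B|K)+\mu\cdot(\overline A|H)$, where $\mu$ is its prevision and $\overline A|H=1-A|H=\overline AH+(1-x)\overline H$. Coherence (betting scheme). To the four objects associate the gains $G_1=H(A-x)$, $G_2=K(B-y)$, $G_3=(A|H)\wedge(B|K)-z$, $G_4=(B|K)|(A|H)-\mu=(A|H)\wedge(B|K)-\mu\,(A|H)$, and the events on which the respective bets are not called off: $L_1=H$, $L_2=K$, $L_3=H\vee K$, and $L_4=$ the event that the quantity $A|H$ is nonzero, i.e. $L_4=AH$ if $x=0$ (in this case $(B|K)|(A|H)=(BK+y\overline K)|AH$) and $L_4=AH\vee\overline H$ if $x\neq0$. The assessment $(x,y,z,\mu)$ is coherent if for every nonempty $S\subseteq\{1,2,3,4\}$ and all real $s_i$ ($i\in S$), the set $D$ of values taken by $\sum_{i\in S}s_iG_i$ on the constituents (generated by $A,B,H,K$) contained in $\bigvee_{i\in S}L_i$ satisfies $\min D\le 0\le\max D$. *)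

(* Defs.v *)
From mathcomp Require Import all_boot all_order all_algebra.
From mathcomp Require Import boolp classical_sets reals.

Set Implicit Arguments.
Unset Strict Implicit.
Unset Printing Implicit Defensive.

Import Order.TTheory GRing.Theory Num.Theory.

Local Open Scope classical_set_scope.
Local Open Scope ring_scope.

Section Events.
Context {disp : Order.disp_t} {T : ctbDistrLatticeType disp}.

Definition literal (b : bool) (E : T) : T := if b then E else (~` E)%O.

Definition literal_conj n (E : n.-tuple T) (s : n.-tuple bool) : T :=
  (\meet_(i < n) literal (tnth s i) (tnth E i))%O.

Definition logically_independent n (E : n.-tuple T) : Prop :=
  forall s : n.-tuple bool, literal_conj E s <> \bot%O.

Definition constituents n (E : n.-tuple T) : set T :=
  [set C | C <> \bot%O /\ exists s : n.-tuple bool, C = literal_conj E s].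

End Events.

(* A random quantity is represented by its values on the constituents, that is
   as a function T -> R of which only the values at constituents matter. *)
Section Quantities.
Context {disp : Order.disp_t} {T : ctbDistrLatticeType disp} {R : realType}.
Implicit Types (A B H K E C : T) (x y z mu : R).

(* A constituent C is contained either in E or in its negation whenever E
   belongs to the algebra generated by the given events; the former means that
   E is true on C. *)
Definition indic E C : R := (C <= E)%O%:R.

Definition cond_event A H x C : R :=
  indic (A `&` H)%O C + x * indic (~` H)%O C.

Definition conj_cond A H B K x y z C : R :=
  if (C <= H `|` K)%O then Num.min (cond_event A H x C) (cond_event B K y C)
  else z.

(* (B|K)|(A|H); the last factor is the negation of A|H, of prevision 1 - x. *)
Definition iter_cond A H B K x y z mu C : R :=
  conj_cond A H B K x y z C + mu * cond_event (~` A)%O H (1 - x) C.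

Definition gain A B H K x y z mu (i : 'I_4) C : R :=
  [:: indic H C * (indic A C - x);
      indic K C * (indic B C - y);
      conj_cond A H B K x y z C - z;
      iter_cond A H B K x y z mu C - mu]`_i.

(* The event on which the i-th bet is in force; for the iterated conditional
   this is the event that the quantity A|H is nonzero. *)
Definition active A H K x (i : 'I_4) : T :=
  nth \bot%O
    [:: H; K; (H `|` K)%O;
        if x == 0 then (A `&` H)%O else ((A `&` H) `|` ~` H)%O] i.

Definition gain_values A B H K x y z mu (S : {set 'I_4}) (s : 'I_4 -> R) :
    set R :=
  [set \sum_(i in S) s i * gain A B H K x y z mu i C
  | C in [set C | constituents [tuple A; B; H; K] C /\
                  (C <= \join_(i in S) active A H K x i)%O]].

Definition is_min (D : set R) (m : R) : Prop := D m /\ lbound D m.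
Definition is_max (D : set R) (m : R) : Prop := D m /\ ubound D m.

Definition coherent A B H K x y z mu : Prop :=
  forall (S : {set 'I_4}) (s : 'I_4 -> R), S != finset.set0 ->
  exists m M : R,
    [/\ is_min (gain_values A B H K x y z mu S s) m,
        is_max (gain_values A B H K x y z mu S s) M & m <= 0 <= M].

End Quantities.

Section Assessments.
Context {R : realType}.

Definition coherent_assessments {disp : Order.disp_t}
    {T : ctbDistrLatticeType disp} (A B H K : T) : set (R * R * R * R) :=
  [set p | let: (x, y, z, mu) := p in coherent A B H K x y z mu].

Definition Pi1 : set (R * R * R * R) :=
  [set p | let: (x, y, z, mu) := p in
    [/\ x \in `]0, 1], y \in `[0, 1],
        z \in `[Num.max (x + y - 1) 0, Num.min x y] & mu = z / x]].

Definition Pi2 : set (R * R * R * R) :=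
  [set p | let: (x, y, z, mu) := p in
    [/\ x = 0, y \in `[0, 1], z = 0 & mu \in `[0, 1]]].

End Assessments.

(* Main.v *)
Require Import Defs.
From mathcomp Require Import all_boot all_order all_algebra.
From mathcomp Require Import boolp classical_sets reals.
From mathcomp Require Import ring lra.

Import Order.Theory GRing.Theory Num.Theory.

Local Open Scope classical_set_scope.

(** Coherence says that no bet is uniformly winning or losing on the active
    constituents. For necessity, each constraint on (x, y, z, mu) is exhibited
    by one combination of bets: G3 - G1, G3 - G2, G3 and G3 - G1 - G2 give the
    Frechet-Hoeffding bounds, and G3 - G4 - mu G1 is the constant mu x - z.
    For sufficiency, a probability on the active constituents with zero
    expected gains is enough: the one on HK with P(AB) = z, P(A) = x,
    P(B) = y if some bet other than the last is made, and the one on AHK with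
    P(B) = mu otherwise. *)

(** * Position of a constituent relative to events of a Boolean algebra *)

Section Constituents.
Context {disp : Order.disp_t} {T : ctbDistrLatticeType disp}.
Implicit Types C E F : T.

(** The conjunction lies below its own [i]-th literal; lying below the opposite one as well would
    make it [\bot]. *)
Lemma literal_conj_le n (E : n.-tuple T) (s : n.-tuple bool) (i : 'I_n) :
  literal_conj E s <> \bot%O ->
  (literal_conj E s <= tnth E i)%O = tnth s i /\
  (literal_conj E s <= ~` tnth E i)%O = ~~ tnth s i.
Proof.
move=> C0; have Cle : (literal_conj E s <= literal (tnth s i) (tnth E i))%O.
  exact: meets_inf.
have nC : ~~ ((literal_conj E s <= tnth E i) &&
              (literal_conj E s <= ~` tnth E i))%O.
  by rewrite -lexI meetxC lex0; apply/eqP.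
by case: (tnth s i) Cle nC => /= -> ; rewrite ?andbT /= => /negbTE ->.
Qed.

(** If [C] were below neither event, it would be below both complements, hence disjoint from the
    join, which a nonzero [C] below that join cannot be. *)
Lemma decided_leU C E F : C <> \bot%O ->
  (C <= ~` E)%O = ~~ (C <= E)%O -> (C <= ~` F)%O = ~~ (C <= F)%O ->
  (C <= E `|` F)%O = (C <= E)%O || (C <= F)%O.
Proof.
move=> C0 dE dF; have [CE|nCE] := boolP (C <= E)%O; first exact: lexUl.
have [CF|nCF] := boolP (C <= F)%O; first exact: lexUr.
apply/negP => CEF; apply: C0; apply/eqP.
by rewrite -lex0 -(meetxC (E `|` F)%O) lexI CEF complU lexI dE dF nCE nCF.
Qed.

End Constituents.

(** * Zero-mean weights and extrema of finite families *)

Local Open Scope ring_scope.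

(** Were [f] positive wherever [w] is, the terms [w i * f i] would be nonnegative with sum zero,
    hence all zero; then every weight would vanish, against total mass 1. *)
Lemma zero_mean_nonpos (R : realType) (I : finType) (w f : I -> R) :
    (forall i, 0 <= w i) -> \sum_i w i = 1 -> \sum_i w i * f i = 0 ->
  exists i, 0 < w i /\ f i <= 0.
Proof.
move=> w0 w1 wf; apply: contrapT => nE.
have fpos i : 0 < w i -> 0 < f i.
  by move=> wi; rewrite ltNge; apply/negP => fi; apply: nE; exists i.
have wf0 i : 0 <= w i * f i.
  have := w0 i; rewrite le_eqVlt => /predU1P[<-|wi]; first by rewrite mul0r.
  by apply: mulr_ge0 => //; apply/ltW/fpos.
have wfi i : w i * f i = 0 by apply: (psumr_eq0P _ wf).
move: w1; rewrite big1 => [/eqP|i _]; first by rewrite eq_sym oner_eq0.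
have := w0 i; rewrite le_eqVlt => /predU1P[//|wi].
by have := mulr_gt0 wi (fpos _ wi); rewrite wfi ltxx.
Qed.

Lemma finite_image_min (R : realType) (I : finType) (P : pred I) (f : I -> R) i0 :
  P i0 -> exists m, is_min [set f i | i in [set i | P i]] m.
Proof.
move=> Pi0; case: (arg_minP f Pi0) => i Pi fi.
by exists (f i); split=> [|_ [j Pj <-]]; [exists i|exact: fi].
Qed.

Lemma finite_image_max (R : realType) (I : finType) (P : pred I) (f : I -> R) i0 :
  P i0 -> exists m, is_max [set f i | i in [set i | P i]] m.
Proof.
move=> Pi0; case: (arg_maxP f Pi0) => i Pi fi.
by exists (f i); split=> [|_ [j Pj <-]]; [exists i|exact: fi].
Qed.

Lemma sum_in_ord4 (V : nmodType) (S : {set 'I_4}) (f : 'I_4 -> V) :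
  \sum_(i in S) f i =
  (if 0 \in S then f 0 else 0) + (if 1 \in S then f 1 else 0) +
  (if 2 \in S then f 2 else 0) + (if 3 \in S then f 3 else 0).
Proof.
rewrite big_mkcond !big_ord_recl big_ord0 /= addr0 !addrA.
have [-> -> ->] : [/\ lift ord0 ord0 = 1 :> 'I_4,
    lift ord0 (lift ord0 ord0) = 2 :> 'I_4 &
    lift ord0 (lift ord0 (lift ord0 ord0)) = 3 :> 'I_4].
  by split; exact/val_inj.
by [].
Qed.

(** * The constituents of [A], [B], [H], [K] and the gains on them *)

Section Coherence.
Context {R : realType} {disp : Order.disp_t} {T : ctbDistrLatticeType disp}.
Context (A B H K : T) (indep : logically_independent [tuple A; B; H; K]).

Definition constituent (a b h k : bool) : T :=
  literal_conj [tuple A; B; H; K] [tuple a; b; h; k].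

Lemma constituentP C :
  constituents [tuple A; B; H; K] C <-> exists a b h k, C = constituent a b h k.
Proof.
split=> [[_ [s ->]]|[a [b [h [k ->]]]]]; last first.
  by split; [exact: indep|exists [tuple a; b; h; k]].
exists (tnth s 0), (tnth s 1), (tnth s 2), (tnth s 3).
congr literal_conj; apply: eq_from_tnth => -[[|[|[|[|//]]]] lt_i4];
  rewrite (tnth_nth false [tuple _; _; _; _]) /=; congr tnth; exact/val_inj.
Qed.

Section Values.
Context (a b h k : bool).
Local Notation C := (constituent a b h k).

Lemma constituent_le :
  [/\ (C <= A)%O = a, (C <= B)%O = b, (C <= H)%O = h & (C <= K)%O = k].
Proof.
pose le i := (literal_conj_le _ _ [tuple a; b; h; k] i (indep _)).1.
by split; [have := le 0|have := le 1|have := le 2|have := le 3];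
  rewrite !(tnth_nth A) !(tnth_nth false).
Qed.

Lemma constituent_leC :
  [/\ (C <= ~` A)%O = ~~ a, (C <= ~` H)%O = ~~ h & (C <= ~` K)%O = ~~ k].
Proof.
pose le i := (literal_conj_le _ _ [tuple a; b; h; k] i (indep _)).2.
by split; [have := le 0|have := le 2|have := le 3];
  rewrite !(tnth_nth A) !(tnth_nth false).
Qed.

Lemma constituent_leHK : (C <= H `|` K)%O = h || k.
Proof.
have [[_ _ CH CK] [_ CnH CnK]] := (constituent_le, constituent_leC).
by rewrite decided_leU ?CH ?CK //; exact: indep.
Qed.

Context (x y z mu : R).

Lemma gain0E : gain A B H K x y z mu 0 C = h%:R * (a%:R - x).
Proof. by rewrite /gain /indic /=; have [-> _ -> _] := constituent_le. Qed.

Lemma gain1E : gain A B H K x y z mu 1 C = k%:R * (b%:R - y).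
Proof. by rewrite /gain /indic /=; have [_ -> _ ->] := constituent_le. Qed.

Hypotheses (x01 : 0 <= x <= 1) (y01 : 0 <= y <= 1).

Definition conj_value : R :=
  if h then if a then if k then b%:R else y else 0
  else if k then if b then x else 0 else z.

Lemma conj_condE : conj_cond A H B K x y z C = conj_value.
Proof.
have [[CA CB CH CK] [_ CnH CnK]] := (constituent_le, constituent_leC).
have [[x0 x1] [y0 y1]] := (andP x01, andP y01).
rewrite /conj_cond constituent_leHK /cond_event /indic !lexI CA CB CH CK.
rewrite CnH CnK /conj_value.
case: a h b k => -[] [] [] /=;
  rewrite ?(mulr0, mulr1, addr0, add0r) //;
  first [exact: min_l|exact: min_r].
Qed.

Lemma gain2E : gain A B H K x y z mu 2 C = conj_value - z.
Proof. by rewrite /gain /= conj_condE. Qed.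

(** The term [mu * (1 - A|H)] absorbs the subtracted prevision [mu], leaving only [- mu * (A|H)]. *)
Lemma gain3E : gain A B H K x y z mu 3 C =
  conj_value - mu * (if h then a%:R else x).
Proof.
have [[_ _ CH _] [CnA CnH _]] := (constituent_le, constituent_leC).
rewrite /gain /= /iter_cond conj_condE /cond_event /indic lexI CH CnA CnH.
by case: (a) (h) => -[]; rewrite /=; ring.
Qed.

End Values.

(** Constituents are indexed by a finite type, so a nonempty set of gain values has its extrema;
    what remains of coherence is one nonpositive and one nonnegative value. *)
Lemma coherentP x y z mu : coherent A B H K x y z mu <->
  forall (S : {set 'I_4}) (s : 'I_4 -> R), S != finset.set0 ->
  exists m M, [/\ gain_values A B H K x y z mu S s m,
                  gain_values A B H K x y z mu S s M & m <= 0 <= M].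
Proof.
split=> [coh S s /(coh S s) [m [M [[Dm _] [DM _] m0M]]]|coh S s S0].
  by exists m, M.
have {coh} [m [M]] := coh S s S0; set J := (\join_(i in S) active A H K x i)%O.
pose P (t : 4.-tuple bool) := (literal_conj [tuple A; B; H; K] t <= J)%O.
have -> : gain_values A B H K x y z mu S s =
    [set \sum_(i in S) s i * gain A B H K x y z mu i
           (literal_conj [tuple A; B; H; K] t) | t in [set t | P t]].
  apply/seteqP; split=> [_ [C [[_ [t ->]] CJ] <-]|_ [t Pt <-]]; first by exists t.
  by eexists; [split; [split; [exact: indep|exists t]|exact: Pt]|].
move=> [[t Pt tm] [t' Pt' tM] /andP[m0 M0]].
have [m' m'_min] := finite_image_min _ _ _
  (fun t => \sum_(i in S) s i * gain A B H K x y z mu i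
             (literal_conj [tuple A; B; H; K] t)) _ Pt.
have [M' M'_max] := finite_image_max _ _ _
  (fun t => \sum_(i in S) s i * gain A B H K x y z mu i
             (literal_conj [tuple A; B; H; K] t)) _ Pt.
exists m', M'; split => //; apply/andP; split.
  by apply: le_trans m0; apply: m'_min.2; exists t.
by apply: le_trans M0 _; apply: M'_max.2; exists t'.
Qed.

(** * Necessity: constraints forced by particular bets *)

Section Necessity.
Context (x y z mu : R) (coh : coherent A B H K x y z mu).

Lemma coherent_values (S : {set 'I_4}) (s : 'I_4 -> R) : S != finset.set0 ->
  (exists a b h k,
    (constituent a b h k <= \join_(i in S) active A H K x i)%O /\
    \sum_(i in S) s i * gain A B H K x y z mu i (constituent a b h k) <= 0) /\
  (exists a b h k,
    (constituent a b h k <= \join_(i in S) active A H K x i)%O /\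
    0 <= \sum_(i in S) s i * gain A B H K x y z mu i (constituent a b h k)).
Proof.
move=> S0; have [m [M [[C [CC CJ] <-] [C' [CC' CJ'] <-] /andP[m0 M0]]]] :=
  (coherentP x y z mu).1 coh S s S0.
move: CC CC' CJ CJ' m0 M0 => /constituentP[a [b [h [k ->]]]].
move=> /constituentP[a' [b' [h' [k' ->]]]] CJ CJ' m0 M0.
by split; [exists a, b, h, k|exists a', b', h', k'].
Qed.

Lemma coherent_x : 0 <= x <= 1.
Proof.
have S0 : [set 0 : 'I_4]%SET != finset.set0 by apply/set0Pn; exists 0; rewrite inE.
have [[a [b [h [k [CJ le0]]]]] [a' [b' [h' [k' [CJ' ge0]]]]]] :=
  coherent_values _ (fun=> 1) S0.
move: CJ CJ' le0 ge0; rewrite !big_set1 !gain0E /active /=.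
have [_ _ -> _] := constituent_le a b h k.
have [_ _ -> _] := constituent_le a' b' h' k'.
by case: h h' a a' => -[] [] [] //= _ _ le0 ge0; lra.
Qed.

Lemma coherent_y : 0 <= y <= 1.
Proof.
have S0 : [set 1 : 'I_4]%SET != finset.set0 by apply/set0Pn; exists 1; rewrite inE.
have [[a [b [h [k [CJ le0]]]]] [a' [b' [h' [k' [CJ' ge0]]]]]] :=
  coherent_values _ (fun=> 1) S0.
move: CJ CJ' le0 ge0; rewrite !big_set1 !gain1E /active /=.
have [_ _ _ ->] := constituent_le a b h k.
have [_ _ _ ->] := constituent_le a' b' h' k'.
by case: k k' b b' => -[] [] [] //= _ _ le0 ge0; lra.
Qed.

(** For [x = 0] the last bet is in force only on [AH], where it pays 0, 1 or [y], all in [0, 1],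
    against [mu]. *)
Lemma coherent_mu : x = 0 -> 0 <= mu <= 1.
Proof.
move=> x0; have y01 := coherent_y.
have S0 : [set 3 : 'I_4]%SET != finset.set0 by apply/set0Pn; exists 3; rewrite inE.
have [[a [b [h [k [CJ le0]]]]] [a' [b' [h' [k' [CJ' ge0]]]]]] :=
  coherent_values _ (fun=> 1) S0.
move: CJ CJ' le0 ge0; rewrite !big_set1 !gain3E ?coherent_x // /active /= x0 eqxx !lexI.
have [-> _ -> _] := constituent_le a b h k.
have [-> _ -> _] := constituent_le a' b' h' k'.
rewrite /conj_value.
by case: a h a' h' => -[] [] [] //= _ _; case: b k b' k' => -[] [] [] //= le0 ge0; lra.
Qed.

Lemma coherent_z : z = mu * x.
Proof.
have ST : [set: 'I_4]%SET != finset.set0 by apply/set0Pn; exists 0; rewrite inE.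
have [[a [b [h [k [_ le0]]]]] [a' [b' [h' [k' [_ ge0]]]]]] :=
  coherent_values _ (fun i : 'I_4 => [:: - mu; 0; 1; -1]`_i) ST.
move: le0 ge0; rewrite !sum_in_ord4 !inE /= !gain0E !gain1E !gain2E ?coherent_x ?coherent_y //.
rewrite !gain3E ?coherent_x ?coherent_y //.
by case: h h' => -[] /= le0 ge0; lra.
Qed.

Lemma coherent_bounds : Num.max (x + y - 1) 0 <= z <= Num.min x y.
Proof.
have [x01 y01] := (coherent_x, coherent_y).
(* The first three bets are all kept, some with stake zero, so that every combination is tested on
   the join of [H] and [K], where [conj_value] avoids its branch [z]. *)
pose S := [set i : 'I_4 | (i < 3)%N]%SET.
have S0 : S != finset.set0 by apply/set0Pn; exists 0; rewrite inE.
have JHK : (\join_(i in S) active A H K x i <= H `|` K)%O.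
  apply/joinsP => -[[|[|[|m]]] ?]; rewrite inE // => _;
    [exact: leUl|exact: leUr].
have bet (c0 c1 c2 : R) := coherent_values _ (fun i : 'I_4 => [:: c0; c1; c2]`_i) S0.
have val a b h k (c0 c1 c2 : R) :
    \sum_(i in S) [:: c0; c1; c2]`_i * gain A B H K x y z mu i (constituent a b h k)
    = c0 * (h%:R * (a%:R - x)) + c1 * (k%:R * (b%:R - y))
      + c2 * (conj_value a b h k x y z - z).
  by rewrite sum_in_ord4 !inE /= gain0E gain1E gain2E // addr0.
rewrite ge_max le_min; apply/andP; split; apply/andP; split.
(* In order, the four combined gains are at least [x + y - 1 - z], at least [- z], at most [x - z]
   and at most [y - z]. *)
- have [[a [b [h [k [/le_trans/(_ JHK) CHK bet0]]]]] _] := bet (-1) (-1) 1.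
  move: CHK bet0; rewrite constituent_leHK val /conj_value.
  by case: a b h k => -[] [] [] //= _; lra.
- have [[a [b [h [k [/le_trans/(_ JHK) CHK bet0]]]]] _] := bet 0 0 1.
  move: CHK bet0; rewrite constituent_leHK val /conj_value.
  by case: a b h k => -[] [] [] //= _; lra.
- have [_ [a [b [h [k [/le_trans/(_ JHK) CHK bet0]]]]]] := bet (-1) 0 1.
  move: CHK bet0; rewrite constituent_leHK val /conj_value.
  by case: a b h k => -[] [] [] //= _; lra.
- have [_ [a [b [h [k [/le_trans/(_ JHK) CHK bet0]]]]]] := bet 0 (-1) 1.
  move: CHK bet0; rewrite constituent_leHK val /conj_value.
  by case: a b h k => -[] [] [] //= _; lra.
Qed.

End Necessity.

(** * Sufficiency: balancing weights on the constituents inside [HK] *)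

Section Sufficiency.
Context (x y z mu : R).
Hypotheses (x01 : 0 <= x <= 1) (y01 : 0 <= y <= 1) (mu01 : 0 <= mu <= 1).
Hypotheses (z_bounds : Num.max (x + y - 1) 0 <= z <= Num.min x y).
Hypothesis (zE : z = mu * x).

(** By linearity every combination of zero-mean bets has mean zero, so it takes values of both weak
    signs on the support of [w], which lies in the active event. *)
Lemma zero_mean_values (S : {set 'I_4}) (s : 'I_4 -> R) (w : bool * bool -> R) :
    (forall p, 0 <= w p) -> \sum_p w p = 1 ->
    (forall p, 0 < w p ->
       (constituent p.1 p.2 true true <= \join_(i in S) active A H K x i)%O) ->
    (forall i, i \in S ->
       \sum_p w p * gain A B H K x y z mu i (constituent p.1 p.2 true true) = 0) ->
  exists m M, [/\ gain_values A B H K x y z mu S s m,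
                  gain_values A B H K x y z mu S s M & m <= 0 <= M].
Proof.
move=> w0 w1 wJ w_mean.
pose f p := \sum_(i in S) s i * gain A B H K x y z mu i (constituent p.1 p.2 true true).
have wf : \sum_p w p * f p = 0.
  under eq_bigr do rewrite mulr_sumr; rewrite exchange_big big1 // => i iS.
  by under eq_bigr do rewrite mulrCA; rewrite -mulr_sumr w_mean ?mulr0.
have fD p : 0 < w p -> gain_values A B H K x y z mu S s (f p).
  move=> wp; exists (constituent p.1 p.2 true true) => //; split; last exact: wJ.
  by apply/constituentP; exists p.1, p.2, true, true.
have [p [wp fp]] := zero_mean_nonpos _ _ _ _ w0 w1 wf.
(* Applied to [- f], the same argument yields a nonnegative value of [f]. *)
have [|q [wq]] := zero_mean_nonpos _ _ _ (fun p => - f p) w0 w1.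
  by under eq_bigr do rewrite mulrN; rewrite sumrN wf oppr0.
rewrite oppr_le0 => fq.
by exists (f p), (f q); rewrite fp fq; split => //; exact: fD.
Qed.

Lemma sum_bool2 (F : bool * bool -> R) : \sum_p F p =
  F (true, true) + F (true, false) + (F (false, true) + F (false, false)).
Proof.
rewrite (eq_bigr (fun p => F (p.1, p.2))) => [|[]//].
by rewrite -(pair_bigA _ (fun a b => F (a, b))) /= !big_bool.
Qed.

Lemma coherent_of_bounds : coherent A B H K x y z mu.
Proof.
have /andP[mu0 mu1] := mu01.
move: z_bounds; rewrite ge_max le_min => /andP[/andP[z1 z2] /andP[z3 z4]].
apply/coherentP => S s S0.
have [/exists_inP[i iS i3]|/exists_inPn S3] := boolP [exists i in S, (i < 3)%N].
(* The four masses of the joint law of [A] and [B] are nonnegative precisely by the four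
   inequalities in [z_bounds]. *)
- pose w p : R := match p with
    | (true, true) => z | (true, false) => x - z
    | (false, true) => y - z | (false, false) => 1 - x - y + z end.
  apply: (zero_mean_values _ _ w) => [[[] []]||p _|j _].
  + by rewrite /=; lra.
  + by rewrite /=; lra.
  + by rewrite /=; lra.
  + by rewrite /=; lra.
  + by rewrite sum_bool2 /=; lra.
  (* Each of the first three active events contains all of [HK], so bet [i] alone puts every
     weighted constituent in force. *)
  + apply: le_trans (joins_sup (active A H K x) iS).
    have [_ _ CH CK] := constituent_le p.1 p.2 true true.
    move: i {iS} i3 => [[|[|[|m]]] ?] //= _; rewrite /active /=.
    by rewrite constituent_leHK.
  + rewrite sum_bool2 /=; have [->|->|->|->] : [\/ j = 0, j = 1, j = 2 | j = 3].
    * by move: j => [[|[|[|[|//]]]] ?]; [constructor 1|constructor 2|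
        constructor 3|constructor 4]; exact/val_inj.
    * by rewrite !gain0E /=; ring.
    * by rewrite !gain1E /=; ring.
    * by rewrite !gain2E // /conj_value /=; ring.
    (* This mean is [z - mu * x]. *)
    * by rewrite !gain3E // /conj_value /= zE; ring.
- have S_3 j : j \in S -> j = 3.
    by move: j => [[|[|[|[|//]]]] lt_j] /S3 //= _; exact/val_inj.
  have inS3 : 3 \in S by have /set0Pn[j jS] := S0; rewrite -(S_3 j jS).
  (* On [AHK] the last gain is [B - mu], so mass [mu] on [B] balances it. *)
  pose w p : R := match p with
    | (true, true) => mu | (true, false) => 1 - mu | _ => 0 end.
  apply: (zero_mean_values _ _ w) => [[[] []]||[[] b]|j /S_3 ->] /=; rewrite ?ltxx //.
  + by rewrite subr_ge0.
  + by rewrite sum_bool2 /=; lra.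
  (* [AH] is contained in the last active event whether or not [x] is zero. *)
  + move=> _; apply: le_trans (joins_sup (active A H K x) inS3).
    have [CA _ CH _] := constituent_le true b true true.
    by rewrite /active /=; case: ifP => _; rewrite ?lexUl // lexI CA CH.
  + by rewrite sum_bool2 /= !gain3E // /conj_value /=; ring.
Qed.

End Sufficiency.

End Coherence.

Theorem theorem3 (R : realType) (disp : Order.disp_t)
    (T : ctbDistrLatticeType disp) (A B H K : T)
    (indepABHK : logically_independent [tuple A; B; H; K]) :
  coherent_assessments A B H K = Pi1 `|` Pi2 :> set (R * R * R * R).
Proof.
apply/seteqP; split=> [[[[x y] z] mu]|[[[x y] z] mu] [[]|[]]].
- move=> coh; have x01 := coherent_x _ _ _ _ indepABHK _ _ _ _ coh.
  have y01 := coherent_y _ _ _ _ indepABHK _ _ _ _ coh.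
  have zE := coherent_z _ _ _ _ indepABHK _ _ _ _ coh.
  (* The relation [z = mu * x] determines [mu] when [x] is nonzero; at [x = 0] it only gives
     [z = 0]. *)
  have [x0|x_neq0] := eqVneq x 0.
    right; split => //; rewrite ?in_itv //=; first by rewrite zE x0 mulr0.
    exact: (coherent_mu _ _ _ _ indepABHK _ _ _ _ coh).
  left; split; rewrite ?in_itv //=.
  + by have /andP[x0 ->] := x01; rewrite lt_def x_neq0 x0.
  + exact: (coherent_bounds _ _ _ _ indepABHK _ _ _ _ coh).
  + by rewrite zE mulfK.
- rewrite !in_itv /= => /andP[x0 x1] y01 z_bounds ->.
  apply: coherent_of_bounds => //; rewrite ?x1 ?(ltW x0) ?divfK ?lt0r_neq0 //.
  (* [z / x] lies in [0, 1] because [0 <= z <= x]. *)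
  move: z_bounds; rewrite ge_max le_min => /andP[/andP[_ z0] /andP[zx _]].
  by rewrite divr_ge0 ?(ltW x0) //= ler_pdivrMr ?mul1r.
- move=> -> y01 -> mu01; move: (y01) mu01; rewrite !in_itv /= => /andP[y0 y1] mu01.
  apply: coherent_of_bounds; rewrite ?mulr0 ?lexx ?ler01 ?y0 //.
  (* At [x = z = 0] the bounds on [z] amount to [y - 1 <= 0] and [0 <= y]. *)
  by rewrite add0r ge_max le_min lexx y0 subr_le0 y1.
Qed.
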